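(* There exist an ergodic measure-preserving dynamical system $(X,\mu,T)$, a point $x\in X$ that is generic for the measure $\mu$, and a continuous function $F\in C(X)$ such that the averages $$\frac1N\sum_{n=1}^N F(T^{\Omega(n)}x)$$ do not converge as $N\to\infty$.
   Context: For $n\in\mathbb{N}=\{1,2,\dots\}$, $\Omega(n)$ denotes the number of prime factors of $n$ counted with multiplicity (so $\Omega(1)=0$). A measure-preserving dynamical system $(X,\mu,T)$ consists of a compact metric space $X$ with its Borel $\sigma$-algebra, a Borel probability measure $\mu$, and a measurable map $T:X\to X$ preserving $\mu$; it is ergodic if every Borel set $A$ with $T^{-1}A=A$ has $\mu(A)\in\{0,1\}$. $C(X)$ is the space of continuous functions on $X$. A point $x\in X$ is generic for $\mu$ if $\lim_{N\to\infty}\frac1N\sum_{n=1}^N f(T^nx)=\int_X f\,d\mu$ for all $f\in C(X)$. *)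

(* Defs.v *)
From HB Require Import structures.
From mathcomp Require Import all_boot all_order all_algebra.
From mathcomp Require Import all_classical all_reals all_analysis.

Set Implicit Arguments.
Unset Strict Implicit.
Unset Printing Implicit Defensive.

Import Order.TTheory GRing.Theory Num.Theory.
Import numFieldNormedType.Exports.

Local Open Scope classical_set_scope.
Local Open Scope ring_scope.

(* Measurable types are pointed in the library while metric types are not; a
   space carrying a probability measure is nonempty, so pointedness costs
   nothing. *)
#[short(type="pmetricType")]
HB.structure Definition PointedMetric (R : numDomainType) :=
  {X of Pointed X & Metric R X}.

Notation borelType X := (g_sigma_algebraType (@open X)).

Definition measure_preserving (R : realType) (d : measure_display)
    (X : measurableType d) (mu : probability X R) (T : X -> X) : Prop :=
  measurable_fun setT T /\
  forall A : set X, measurable A -> mu (T @^-1` A) = mu A.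

Definition ergodic (R : realType) (d : measure_display)
    (X : measurableType d) (mu : probability X R) (T : X -> X) : Prop :=
  forall A : set X, measurable A -> T @^-1` A = A ->
    mu A = 0%E \/ mu A = 1%E.

(* The value at N = 0 is the junk value 0. *)
Definition average (R : realType) (a : nat -> R) : nat -> R :=
  fun N => N%:R^-1 * \sum_(1 <= n < N.+1) a n.

(* Real-valued test functions: by taking real and imaginary parts, the
   complex-valued notion is the same. *)
Definition generic (R : realType) (X : pmetricType R)
    (mu : probability (borelType X) R) (T : X -> X) (x : X) : Prop :=
  forall f : X -> R, continuous f ->
    average (fun n => f (iter n T x)) @ \oo --> \int[mu]_y f y.

Definition prime_Omega (n : nat) : nat := (\sum_(p <- primes n) logn p n)%N.

(* Main.v *)
Require Import Defs.
From HB Require Import structures.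
From mathcomp Require Import all_boot all_order all_algebra.
From mathcomp Require Import all_classical all_reals all_analysis.
From mathcomp Require Import measurable_realfun ring lra zify.
Import Order.TTheory GRing.Theory Num.Theory.
Import numFieldNormedType.Exports.

Local Open Scope classical_set_scope.
Local Open Scope ring_scope.

(** For n <= N the values Omega n crowd around S N, the sum of 1 / p over the
    primes p <= N: Turan's second moment argument bounds the typical distance
    to S N by a multiple of the square root of S N.  So a set of integers with
    density zero can still capture almost all values Omega n with n <= N, as
    soon as it contains an interval around S N of length much larger than
    sqrt (S N) but much smaller than S N.  Since S N tends to infinity with
    increments less than 1, it reaches any prescribed height, and the set W made
    of the windows [i ^ 5, i ^ 5 + 2 i ^ 3 + 1] works: W has density zero,
    almost all Omega n are in W when S N is at the centre of a window, and almost
    none when S N is in the gap between two windows.  Hence the averages of the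
    indicator of W along Omega oscillate ([average_in_window_Omega_dvg]),
    although its averages along all integers tend to 0
    ([average_in_window_cvg0]).

    Only the following is used about primes.  Counting multiples with an error
    of at most 1 for each prime gives the first two moments of the number of
    distinct prime divisors in terms of S N itself ([turan]), so that no
    asymptotics for S N are needed.  Repeated prime factors contribute a bounded
    amount on average ([sum_Omega_sub_omega_le]).  Finally S is unbounded
    ([recip_primes_step]): the logarithm of N! is about N log N, and the primes
    below a fixed M account only for O(N) of it.

    On the dynamical side, every 0-1 sequence with density zero is read along an
    orbit of a system whose measure is a Dirac mass
    ([density_zero_realization]).  In [0, 1], choose distinct points x_n tending
    to 0 along the zeros of the sequence and to 1 along its ones, and let T send
    x_n to x_(n+1) and every other point to the fixed point 0.  This T is Borel
    because it is constant outside a countable set, and the Dirac mass at 0 is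
    invariant and ergodic; as the orbit is near 0 for all but a density zero set
    of times, x_0 is generic for it.  A continuous function equal to 0 near 0
    and to 1 near 1 recovers the sequence. *)

(** * Prime factors counted on average *)

Lemma prime_Omega_sum (n N : nat) : (0 < n <= N)%N ->
  prime_Omega n = (\sum_(1 <= p < N.+1 | prime p) logn p n)%N.
Proof.
move=> /andP[n_gt0 nN]; rewrite /prime_Omega.
rewrite [RHS](bigID (fun p => p \in primes n))/=.
rewrite [X in (_ + X)%N]big1 ?addn0; last first.
  by move=> p /andP[_]; rewrite -logn_gt0 lt0n negbK => /eqP.
rewrite -[RHS]big_filter; apply: perm_big; apply: uniq_perm.
- exact: primes_uniq.
- by rewrite filter_uniq // iota_uniq.
move=> p; rewrite mem_filter mem_index_iota mem_primes.
case: (boolP (prime p)) => //= pp; rewrite n_gt0 /=.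
case: (boolP (p %| n)%N) => //= pn.
by rewrite prime_gt0 //= ltnS (leq_trans (dvdn_leq n_gt0 pn)).
Qed.

Definition recip_primes (R : realType) (N : nat) : R :=
  \sum_(1 <= p < N.+1 | prime p) p%:R^-1.

(** For 0 < n <= N this is the number of distinct prime divisors of n; the cutoff N
    gives all n <= N the same range of summation, so that sums can be
    exchanged. *)
Definition omega_upto (N n : nat) : nat :=
  (\sum_(1 <= p < N.+1 | prime p) (p %| n))%N.

Section Turan.
Variable R : realType.
Implicit Types (n N p q m k : nat).
Local Notation S := (@recip_primes R).

Lemma recip_primes_ge0 N : 0 <= S N.
Proof. by apply: sumr_ge0 => p _; rewrite invr_ge0. Qed.

Lemma recip_primesS N :
  S N.+1 = S N + (if prime N.+1 then N.+1%:R^-1 else 0).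
Proof. by rewrite /recip_primes big_mkcond big_nat_recr //= -big_mkcond. Qed.

Lemma recip_primesS_bounds N : S N <= S N.+1 < S N + 1.
Proof.
rewrite recip_primesS lerDl ltrD2l; case: ifP => [/prime_gt1 N1|_].
  by rewrite invr_ge0 ler0n /= invf_lt1 // ltr1n.
by rewrite lexx ltr01.
Qed.

Lemma recip_primes_le N : S N <= N%:R.
Proof.
elim: N => [|N IH]; first by rewrite /recip_primes big_geq.
have /andP[_ /ltW /le_trans ->//] := recip_primesS_bounds N.
by rewrite -[leRHS]natr1 lerD2r.
Qed.

Lemma divn_natr_le n d : (n %/ d)%:R <= n%:R / d%:R :> R.
Proof.
case: d => [|d]; first by rewrite divn0 invr0 mulr0.
by rewrite ler_pdivlMr ?ltr0n // -natrM ler_nat leq_divM.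
Qed.

Lemma divn_natr_ge n d : (0 < d)%N -> n%:R / d%:R - 1 <= (n %/ d)%:R :> R.
Proof.
move=> d0; rewrite lerBlDr ler_pdivrMr ?ltr0n // natr1 -natrM ler_nat.
by rewrite ltnW // ltn_ceil.
Qed.

Lemma sum_omega_upto N :
  (\sum_(1 <= n < N.+1) omega_upto N n =
   \sum_(1 <= p < N.+1 | prime p) N %/ p)%N.
Proof.
rewrite exchange_big /=; apply: eq_bigr => p _; exact/esym/divn_count_dvd.
Qed.

(** Each of the at most N primes loses less than 1 when N / p is rounded
    down. *)
Lemma sum_omega_upto_ge N :
  N%:R * S N - N%:R <= (\sum_(1 <= n < N.+1) omega_upto N n)%:R.
Proof.
rewrite sum_omega_upto natr_sum mulr_sumr.
have {2}-> : N%:R = \sum_(1 <= p < N.+1) (1 : R).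
  by rewrite sumr_const_nat subn1.
rewrite [in leLHS]big_mkcond [in leRHS]big_mkcond -sumrB !big_nat /=.
apply: ler_sum => p /andP[p0 _]; case: ifP => _; last by lra.
exact: divn_natr_ge.
Qed.

(** Expanding the square counts the multiples of both p and q; distinct primes
    are independent up to rounding, which yields the square of S N, and the
    diagonal p = q yields S N. *)
Lemma sum_omega_upto_sqr_le N :
  (\sum_(1 <= n < N.+1) omega_upto N n ^ 2)%:R <= N%:R * (S N ^+ 2 + S N).
Proof.
have -> : (\sum_(1 <= n < N.+1) omega_upto N n ^ 2 =
    \sum_(1 <= p < N.+1 | prime p) \sum_(1 <= q < N.+1 | prime q)
      \sum_(1 <= n < N.+1) (p %| n) * (q %| n))%N.
  under [RHS]eq_bigr do rewrite exchange_big /=.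
  rewrite [RHS]exchange_big /=; apply: eq_bigr => n _.
  rewrite expnS expn1 /omega_upto big_distrl /=; apply: eq_bigr => p _.
  by rewrite big_distrr.
rewrite mulrDr expr2 {1}/recip_primes mulr_suml !mulr_sumr -big_split /=.
rewrite natr_sum; apply: ler_sum => p pp.
rewrite (bigID (pred1 p)) /= natrD addrC lerD //; last first.
  (* Off the diagonal, p and q divide n exactly when p * q does. *)
  rewrite natr_sum /recip_primes !mulr_sumr.
  rewrite [leRHS](bigID (pred1 p)) /= ler_wpDl //.
    by apply: sumr_ge0 => q _; rewrite !mulr_ge0.
  apply: ler_sum => q /andP[pq qp].
  rewrite -invfM -natrM; apply: le_trans (divn_natr_le _ _).
  rewrite ler_nat divn_count_dvd; apply: leq_sum => n _.
  by rewrite Gauss_dvd ?mulnb // prime_coprime // dvdn_prime2 // eq_sym.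
apply: le_trans (divn_natr_le _ _); rewrite ler_nat.
case: (boolP (p \in index_iota 1 N.+1)) => pN; last first.
  by rewrite big1_seq // => q /andP[/andP[_ /eqP ->]]; rewrite (negPf pN).
have pE : [seq q <- index_iota 1 N.+1 | prime q && (q == p)] = [:: p].
  rewrite (eq_filter (a2 := pred1 p)) ?filter_pred1_uniq ?iota_uniq //.
  by move=> q /=; case: eqP => [->|]; rewrite ?pp ?andbF.
rewrite -big_filter pE big_seq1 divn_count_dvd.
by apply: leq_sum => n _; rewrite mulnb andbb.
Qed.

(** Turan's inequality.  The main terms N * S N ^+ 2 of the expanded square
    cancel, and what remains is linear in S N. *)
Lemma turan N :
  \sum_(1 <= n < N.+1) ((omega_upto N n)%:R - S N) ^+ 2 <= 3 * N%:R * S N.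
Proof.
have E n : ((omega_upto N n)%:R - S N) ^+ 2 =
    (omega_upto N n ^ 2)%N%:R + (- 2 * S N) * (omega_upto N n)%:R + S N ^+ 2.
  by rewrite natrX; ring.
under eq_bigr do rewrite E.
rewrite !big_split /= -natr_sum -mulr_sumr -natr_sum sumr_const_nat subn1 /=.
rewrite -[X in _ + X]mulr_natl.
have := sum_omega_upto_sqr_le N.
have := ler_wpM2l (recip_primes_ge0 N) (sum_omega_upto_ge N).
move: (\sum_(1 <= n < N.+1) omega_upto N n ^ 2)%N => A.
move: (\sum_(1 <= n < N.+1) omega_upto N n)%N => B.
move: (S N) A%:R B%:R N%:R => s {}A {}B M; lra.
Qed.

(** The ratio is at most 1 / 2, so the term of index k is dominated by the
    increment of - 2 / p ^ k. *)
Lemma geometric_tail_le p m n : (1 < p)%N ->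
  \sum_(m <= k < n) ((p ^ k)%N%:R^-1 : R) <= 2 / (p ^ m)%N%:R.
Proof.
move=> p1.
have p0 k : 0 < (p ^ k)%N%:R :> R by rewrite ltr0n expn_gt0 ltnW.
case: (leqP m n) => [mn|/ltnW mn]; last first.
  rewrite big_geq //; exact: divr_ge0.
suff : \sum_(m <= k < n) ((p ^ k)%N%:R^-1 : R) <=
    \sum_(m <= k < n) (- 2 / (p ^ k.+1)%N%:R - - 2 / (p ^ k)%N%:R).
  rewrite telescope_sumr // => /le_trans; apply.
  by rewrite !mulNr opprK gerDr oppr_le0; exact: divr_ge0.
apply: ler_sum => k _; rewrite expnS natrM invfM.
have p2 : p%:R^-1 <= 2^-1 :> R by rewrite lef_pV2 ?posrE ?ler_nat ?ltr0n // ltnW.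
have : 0 <= (p ^ k)%N%:R^-1 :> R by rewrite invr_ge0 ler0n.
move: p2; move: (p%:R^-1) ((p ^ k)%N%:R^-1) => x y x2 y0.
have := ler_wpM2r y0 x2; lra.
Qed.

(** Legendre's formula writes the exponent of p in N! as the sum of the N %/ p ^ k
    over k >= 1.  The tail from m = 1 bounds the whole exponent; the tail from
    m = 2 bounds the contribution of repeated factors. *)
Lemma logn_fact_tail p N m : (1 < p)%N ->
  (\sum_(m <= k < N.+1) N %/ p ^ k)%:R <= 2 * N%:R / (p ^ m)%N%:R :> R.
Proof.
move=> p1; rewrite natr_sum (mulrC 2) -mulrA.
apply: le_trans (ler_wpM2l _ (@geometric_tail_le p m N.+1 p1)) => //.
by rewrite mulr_sumr; apply: ler_sum => k _; exact: divn_natr_le.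
Qed.

Lemma logn_fact_le p N : prime p -> (logn p N`!)%:R <= 2 * N%:R / p%:R :> R.
Proof.
move=> pp; rewrite logn_fact //.
by have := @logn_fact_tail p N 1 (prime_gt1 pp); rewrite expn1.
Qed.

Lemma omega_upto_le_Omega n N : (0 < n <= N)%N ->
  (omega_upto N n <= prime_Omega n)%N.
Proof.
move=> nN; have /andP[n0 _] := nN; rewrite (prime_Omega_sum _ _ nN).
apply: leq_sum => p pp; case: (boolP (p %| n)%N) => //= pn.
by rewrite logn_gt0 mem_primes pp n0.
Qed.

(** Comparison with the telescoping series of 1 / (k - 1) - 1 / k. *)
Lemma sum_recip_sqr_le n : \sum_(2 <= k < n.+2) (k%:R ^+ 2)^-1 <= 1 :> R.
Proof.
suff: \sum_(2 <= k < n.+2) (k%:R ^+ 2)^-1 <= 1 - n.+1%:R^-1 :> R.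
  by move/le_trans; apply; rewrite gerBl invr_ge0.
elim: n => [|n IH]; first by rewrite big_geq // invr1; lra.
rewrite big_nat_recr //=; apply: le_trans (lerD IH (lexx _)) _.
have n1 : 0 < n.+1%:R :> R by rewrite ltr0n.
have -> : n.+2%:R = n.+1%:R + 1 :> R by rewrite natr1.
move: n1; move: (n.+1%:R) => x x0.
rewrite -subr_ge0.
have -> : 1 - (x + 1)^-1 - (1 - x^-1 + ((x + 1) ^+ 2)^-1) =
    (x * (x + 1) ^+ 2)^-1.
  by field; rewrite !gt_eqF //; lra.
by rewrite invr_ge0 mulr_ge0 ?exprn_ge0 //; lra.
Qed.

Lemma logn_fact_sum p N : logn p N`! = (\sum_(1 <= n < N.+1) logn p n)%N.
Proof.
elim: N => [|N IH]; first by rewrite big_geq // logn1.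
by rewrite factS lognM ?fact_gt0 // addnC IH [RHS]big_nat_recr.
Qed.

(** The excess is the sum over p of the number of multiples of p ^ 2, p ^ 3, and
    so on, hence O(N / p ^ 2) for each p, which is summable. *)
Lemma sum_Omega_sub_omega_le N :
  \sum_(1 <= n < N.+1) ((prime_Omega n)%:R - (omega_upto N n)%:R) <=
  2 * N%:R :> R.
Proof.
have Omega_fact : (\sum_(1 <= n < N.+1) prime_Omega n =
    \sum_(1 <= p < N.+1 | prime p) logn p N`!)%N.
  under [RHS]eq_bigr do rewrite logn_fact_sum.
  rewrite exchange_big /= !big_nat; apply: eq_bigr => n nN.
  exact: prime_Omega_sum.
rewrite sumrB -!natr_sum Omega_fact sum_omega_upto !natr_sum -sumrB.
clear Omega_fact.
have term_le p : prime p ->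
    (logn p N`!)%:R - (N %/ p)%:R <= 2 * N%:R * (p%:R ^+ 2)^-1 :> R.
  move=> pp; rewrite logn_fact //.
  case: N => [|N]; first by rewrite big_geq // div0n subrr mulr0 mul0r.
  rewrite big_ltn // expn1 natrD addrC addKr -natrX.
  exact: logn_fact_tail (prime_gt1 pp).
apply: le_trans (ler_sum _ (fun p => @term_le p)) _.
rewrite -mulr_sumr ler_piMr ?mulr_ge0 //.
case: N {term_le} => [|N]; first by rewrite big_geq // ler01.
rewrite big_mkcond big_ltn //= add0r -big_mkcond /=.
apply: le_trans (sum_recip_sqr_le N).
rewrite [leRHS](bigID prime) /= lerDl; apply: sumr_ge0 => k _.
by rewrite invr_ge0 exprn_ge0.
Qed.

End Turan.

(** * Divergence of the sum of the reciprocals of the primes *)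

Section RecipPrimes.
Variable R : realType.
Implicit Types (n N p M k : nat).
Local Notation S := (@recip_primes R).

(** Induction, with ln (1 + 1 / n) <= 1 / n. *)
Lemma ln_fact_ge n : n%:R * ln n%:R - n%:R <= ln (n`!)%:R :> R.
Proof.
elim: n => [|n IH]; first by rewrite mul0r subrr fact0 ln1.
have n1 : 0 < n.+1%:R :> R by rewrite ltr0n.
rewrite factS natrM lnM ?posrE ?ltr0n ?fact_gt0 // -lerBlDl.
apply: le_trans IH.
case: n n1 => [|n] n1; first by rewrite ln1; lra.
have n0 : 0 < n.+1%:R :> R by rewrite ltr0n.
have : ln (n.+2%:R) - ln n.+1%:R <= n.+1%:R^-1 :> R.
  rewrite -ln_div ?posrE //.
  have -> : n.+2%:R / n.+1%:R = 1 + n.+1%:R^-1 :> R.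
    by rewrite -[n.+2%:R]natr1 mulrDl mul1r divff // gt_eqF.
  by apply: le_ln1Dx; rewrite (lt_trans (ltrN10 _)) // invr_gt0.
rewrite -(ler_pM2l n0) divff ?gt_eqF // -[n.+2%:R]natr1.
move: (ln _) (ln _) => u v; lra.
Qed.

Lemma ln_natr_prod (I : Type) (r : seq I) (P : pred I) (F : I -> nat) :
  (forall i, P i -> (0 < F i)%N) ->
  ln (\prod_(i <- r | P i) F i)%N%:R = \sum_(i <- r | P i) ln (F i)%:R :> R.
Proof.
move=> F0.
pose K (x : nat) (y : R) := (0 < x)%N /\ ln x%:R = y.
suff: K (\prod_(i <- r | P i) F i)%N (\sum_(i <- r | P i) ln (F i)%:R) by case.
apply: (big_rec2 K) => [|i y x Pi [x0 <-]]; first by split; rewrite ?ln1.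
split; first by rewrite muln_gt0 F0.
by rewrite natrM lnM ?posrE ?ltr0n ?F0.
Qed.

Lemma ln_natr_primes n N : (0 < n <= N)%N ->
  ln n%:R = \sum_(1 <= p < N.+1 | prime p) (logn p n)%:R * ln p%:R :> R.
Proof.
move=> /andP[n0 nN]; rewrite -{1}(partnT n0) (widen_partn _ nN).
rewrite ln_natr_prod => [|p _]; last first.
  by case: p => [|p]; rewrite expn_gt0 //= lognE.
rewrite big_ltn //= {1}lognE /= expn0 ln1 add0r.
rewrite [RHS]big_mkcond; apply: eq_bigr => p _ /=.
case: ifP => [pp|npp]; last by rewrite lognE npp expn0 ln1.
by rewrite natrX lnXn ?ltr0n ?prime_gt0 // mulr_natl.
Qed.

Lemma ln_fact_primes N :
  ln (N`!)%:R = \sum_(1 <= p < N.+1 | prime p) (logn p N`!)%:R * ln p%:R :> R.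
Proof.
under [RHS]eq_bigr do rewrite logn_fact_sum natr_sum mulr_suml.
rewrite exchange_big /= fact_prod !big_nat ln_natr_prod => [|n /andP[]//].
by apply: eq_bigr => n nN; exact: ln_natr_primes.
Qed.

(** If the primes between M and N contributed less than 1 / 4 to S N, then in
    the factorization of N! they would account for at most (N ln N) / 2 of
    ln N!, and those up to M for at most 2 N S(M) ln (M + 1).  This contradicts
    ln N! >= N ln N - N as soon as ln N exceeds the constant C below. *)
Lemma recip_primes_step M : exists N, S M + 4^-1 <= S N.
Proof.
(* Solves ln N / 2 = 1 + 2 * (S M * ln M.+1) for ln N. *)
pose C := 4 * (S M * ln M.+1%:R) + 2.
have SM0 := recip_primes_ge0 R M.
have lnM0 : 0 <= ln M.+1%:R :> R by rewrite ln_ge0 // ler1n.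
have [N0 N0C] : exists N, expR C < N%:R.
  by exists (Num.Def.truncn (expR C)).+1; exact: truncnS_gt.
exists (M + N0)%N; set N := (M + N0)%N.
have lnN : C < ln N%:R.
  rewrite -ltr_expR lnK ?posrE; last first.
    rewrite (lt_le_trans _ (_ : N0%:R <= N%:R)) ?ler_nat ?leq_addl //.
    by rewrite (lt_trans _ N0C) // expR_gt0.
  by rewrite (lt_le_trans N0C) // ler_nat leq_addl.
have N0' : 0 < N%:R :> R.
  rewrite (lt_le_trans _ (_ : N0%:R <= N%:R)) ?ler_nat ?leq_addl //.
  by rewrite (lt_trans _ N0C) // expR_gt0.
rewrite leNgt; apply/negP => SN.
have := ln_fact_ge N; rewrite ln_fact_primes.
have Ssplit : S N = S M + \sum_(M.+1 <= p < N.+1 | prime p) p%:R^-1.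
  by rewrite /recip_primes (big_cat_nat _ (n := M.+1)) // ltnS leq_addr.
rewrite (big_cat_nat _ (n := M.+1)) //=; last by rewrite ltnS leq_addr.
have h1 : \sum_(1 <= p < M.+1 | prime p) (logn p N`!)%:R * ln p%:R <=
    2 * N%:R * ln M.+1%:R * S M :> R.
  rewrite mulr_sumr big_nat_cond [leRHS]big_nat_cond; apply: ler_sum => p.
  move=> /andP[/andP[p1 pM] pp].
  rewrite mulrAC ler_pM ?logn_fact_le ?ln_ge0 ?ler1n //.
  by rewrite ler_ln ?posrE ?ltr0n ?ler_nat // ltnW.
have h2 : \sum_(M.+1 <= p < N.+1 | prime p) (logn p N`!)%:R * ln p%:R <=
    2 * N%:R * ln N%:R * (S N - S M) :> R.
  rewrite Ssplit addrC addKr mulr_sumr big_nat_cond [leRHS]big_nat_cond.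
  apply: ler_sum => p /andP[/andP[p1 pM] pp].
  have p0 := prime_gt0 pp.
  rewrite mulrAC ler_pM ?logn_fact_le ?ln_ge0 ?ler1n //.
  by rewrite ler_ln ?posrE ?ltr0n ?ler_nat //; lia.
move=> h3; have := le_trans h3 (lerD h1 h2).
have h4 : 2 * N%:R * ln N%:R * (S N - S M) <= 2 * N%:R * ln N%:R * 4^-1 :> R.
  apply: ler_wpM2l; last by lra.
  by rewrite mulr_ge0 //; rewrite /C in lnN; have := mulr_ge0 SM0 lnM0; lra.
move=> /le_trans /(_ (lerD (lexx _) h4)).
suff: N%:R * (ln N%:R / 2 - 1 - 2 * (S M * ln M.+1%:R)) > 0.
  by move: N%:R (ln N%:R) (ln M.+1%:R) (S M) => n u v s; lra.
by apply: mulr_gt0 => //; rewrite /C in lnN; lra.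
Qed.

(** S is unbounded with increments less than 1, so the first N at which it
    reaches c overshoots by less than 1. *)
Lemma exists_recip_primes (c : nat) :
  exists2 N, (c <= N)%N & c%:R <= S N < c%:R + 1.
Proof.
have unbounded k : exists M, k%:R / 4 <= S M.
  elim: k => [|k [M IH]]; first by exists 0%N; rewrite mul0r recip_primes_ge0.
  have [N MN] := recip_primes_step M; exists N.
  by apply: le_trans MN; rewrite -natr1; lra.
have ex : exists M, c%:R <= S M.
  have [M cM] := unbounded (4 * c)%N; exists M.
  by apply: le_trans cM; rewrite natrM; lra.
case: (ex_minnP ex) => N cN minN; exists N.
  by rewrite -(ler_nat R) (le_trans cN) // recip_primes_le.
rewrite cN /=; case: N cN minN => [|N] cN minN.
  by rewrite /recip_primes big_geq // ltr_wpDl.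
have /andP[_ /lt_le_trans ->//] := recip_primesS_bounds R N.
rewrite lerD2r leNgt; apply/negP => /ltW /minN.
by rewrite ltnn.
Qed.

End RecipPrimes.

(** * Concentration of Omega around the sum of prime reciprocals *)

(** If Omega n is at distance more than r from S N, then either Omega n exceeds
    the number of distinct prime divisors by r / 2, which is bounded by the
    first moment, or the latter is at distance more than r / 2 from S N, which
    is bounded by Turan's inequality. *)
Lemma sum_Omega_dev_le (R : realType) (N : nat) (r : R) : 0 < r ->
  (\sum_(1 <= n < N.+1) (r < `|(prime_Omega n)%:R - recip_primes R N|)%R)%:R <=
  N%:R * (4 / r + 12 * recip_primes R N / r ^+ 2).
Proof.
move=> r0; rewrite natr_sum.
have -> : N%:R * (4 / r + 12 * recip_primes R N / r ^+ 2) =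
    2 / r * (2 * N%:R) + 4 / r ^+ 2 * (3 * N%:R * recip_primes R N).
  by field; rewrite gt_eqF.
have c1 : 0 <= 2 / r by rewrite divr_ge0 // ltW.
have c2 : 0 <= 4 / r ^+ 2 by rewrite divr_ge0 // exprn_ge0 // ltW.
apply: le_trans _ (lerD (ler_wpM2l c1 (sum_Omega_sub_omega_le R N))
                      (ler_wpM2l c2 (turan R N))).
rewrite !mulr_sumr -big_split /= big_nat [leRHS]big_nat.
apply: ler_sum => n nN.
have : (omega_upto N n)%:R <= (prime_Omega n)%:R :> R.
  by rewrite ler_nat omega_upto_le_Omega.
move: (prime_Omega n)%:R (omega_upto N n)%:R (recip_primes R N) => u v s vu.
have t1 : 0 <= 2 / r * (u - v) by rewrite mulr_ge0 // subr_ge0.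
have t2 : 0 <= 4 / r ^+ 2 * (v - s) ^+ 2 by rewrite mulr_ge0 // sqr_ge0.
case: ltP => [dev|_]; last by rewrite addr_ge0.
have [uv|uv] := leP (r / 2) (u - v).
  apply: ler_wpDr => //.
  have := ler_wpM2l c1 uv; rewrite mulrA divfK ?divff ?gt_eqF //.
have vs : r / 2 < `|v - s|.
  have : `|u - s| <= `|u - v| + `|v - s| := ler_distD _ _ _.
  rewrite (ger0_norm (_ : 0 <= u - v)) ?subr_ge0 //.
  by move: dev uv; move: (`|_|) (`|_|) => a b; lra.
apply: ler_wpDl => //.
have : (r / 2) ^+ 2 <= (v - s) ^+ 2.
  rewrite -[leRHS]real_normK ?num_real //.
  by apply: lerXn2r; rewrite ?nnegrE ?(ltW vs) // divr_ge0 // ltW.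
move/(ler_wpM2l c2); rewrite (_ : 4 / r ^+ 2 * (r / 2) ^+ 2 = 1) //.
by field; rewrite gt_eqF.
Qed.

(** The form in which concentration is used: for a window of centre x and
    half-width y large compared with sqrt x, some N has at least two thirds of
    the Omega n in the window.  The extra 1 at the upper end absorbs the
    overshoot of S N over x, and y is added on the left of the inequalities so
    that no truncated subtraction occurs. *)
Lemma Omega_concentration (R : realType) (x y : nat) :
  (24 <= y -> 72 * x.+1 <= y ^ 2 ->
  exists2 N, x <= N &
    3 * \sum_(1 <= n < N.+1) ~~ (x <= prime_Omega n + y <= x + 2 * y + 1)
      <= N)%N.
Proof.
move=> y24 xy.
have [N xN /andP[SN1 SN2]] := exists_recip_primes R x.
exists N => //.
have y0 : 0 < y%:R :> R by rewrite ltr0n; lia.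
have := @sum_Omega_dev_le R N y%:R y0.
have : (\sum_(1 <= n < N.+1) ~~ (x <= prime_Omega n + y <= x + 2 * y + 1) <=
  \sum_(1 <= n < N.+1) (y%:R < `|(prime_Omega n)%:R - recip_primes R N|)%R)%N.
  apply: leq_sum => n _; case: (ltP y%:R) => [_|]; first by case: (~~ _).
  rewrite ler_norml => /andP[lo hi]; rewrite leqn0 eqb0 negbK.
  apply/andP; split.
    rewrite -(ler_nat R) natrD.
    by move: SN1 SN2 lo hi; move: x%:R y%:R => r t; lra.
  rewrite -(ler_nat R) mul2n -addnn !natrD.
  by move: SN1 SN2 lo hi; move: x%:R y%:R => r t; lra.
move: (\sum_(1 <= n < N.+1) _)%N (\sum_(1 <= n < N.+1) _)%N => A B.
rewrite -(ler_nat R) -[in X in _ -> _ -> X](ler_nat R) natrM => /le_trans AB /AB.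
move=> /le_trans h; apply: le_trans (_ : 3 * (N%:R * (1/3)) <= _); last by lra.
apply: ler_wpM2l => //; apply: h; apply: ler_wpM2l => //.
have h1 : 4 / y%:R <= 1 / 6 :> R.
  by rewrite ler_pdivrMr // ; move: y24; rewrite -(ler_nat R); lra.
have h2 : 12 * recip_primes R N / y%:R ^+ 2 <= 1 / 6 :> R.
  rewrite ler_pdivrMr ?exprn_gt0 //.
  by move: xy; rewrite -(ler_nat R) natrX natrM -natr1; lra.
lra.
Qed.

(** * A set of density zero made of windows *)

Lemma count_interval a b M :
  (\sum_(1 <= n < M.+1) (a <= n <= b) <= b.+1 - a)%N.
Proof.
rewrite (eq_bigr (fun n => if a <= n <= b then 1 else 0)%N); last first.
  by move=> n _; case: ifP.
rewrite -big_mkcond -big_filter sum1_size -(size_iota a (b.+1 - a)).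
apply: uniq_leq_size; first by rewrite filter_uniq // iota_uniq.
by move=> n; rewrite mem_filter => /andP[nab _]; rewrite mem_iota; lia.
Qed.

(** The exponents 5 and 3 leave room on both sides: a window at height h = i ^ 5
    has length about h ^ (3 / 5), more than the spread h ^ (1 / 2) of Omega, while
    the gap to the next one has length of order h ^ (4 / 5).  Any i that is
    admissible for n is at most n, whence the bounded quantifier. *)
Definition in_window (n : nat) : bool :=
  [exists i : 'I_n.+1, (0 < i) && (i ^ 5 <= n <= i ^ 5 + 2 * i ^ 3 + 1)]%N.

Lemma in_windowP n :
  reflect (exists2 i, 0 < i & i ^ 5 <= n <= i ^ 5 + 2 * i ^ 3 + 1)%N
          (in_window n).
Proof.
apply: (iffP existsP) => [[i /andP[i0 iw]]|[i i0 iw]]; first by exists i.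
suff ilt : (i < n.+1)%N by exists (Ordinal ilt); rewrite i0.
have /andP[+ _] := iw; rewrite ltnS; apply: leq_trans.
by rewrite -{1}(expn1 i) leq_pexp2l.
Qed.

(** With j the integer part of the fifth root of M, the j windows that start
    below M have at most 4 j ^ 3 elements each, and 4 j ^ 4 is at most
    (4 / j) * M. *)
Lemma in_window_density K M : (K.+1 ^ 5 <= M)%N ->
  (K * \sum_(1 <= n < M.+1) in_window n <= 4 * M)%N.
Proof.
move=> KM.
have exj : exists j, (M < j.+1 ^ 5)%N.
  by exists M; rewrite (leq_trans (ltnSn M)) // -{1}(expn1 M.+1) leq_pexp2l.
case: (ex_minnP exj) => j Mj minj.
have Kj : (K < j)%N by rewrite -ltnS -(@ltn_exp2r _ _ 5) // (leq_ltn_trans KM).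
have jM : (j ^ 5 <= M)%N.
  case: j Kj {Mj} minj => // j _ minj.
  by rewrite leqNgt; apply/negP=> /minj; rewrite ltnn.
suff : (\sum_(1 <= n < M.+1) in_window n <= j * (4 * j ^ 3))%N.
  move=> cnt; apply: leq_trans (leq_mul (ltnW Kj) cnt) _.
  apply: leq_trans (leq_mul (leqnn 4) jM).
  by rewrite !expnS expn0; lia.
apply: (@leq_trans (\sum_(1 <= n < M.+1) \sum_(1 <= i < j.+1)
    (i ^ 5 <= n <= i ^ 5 + 2 * i ^ 3 + 1)))%N.
  rewrite big_nat [leqRHS]big_nat; apply: leq_sum => n /andP[n0 nM].
  case: in_windowP => // -[i i0 iw].
  have ij : (i < j.+1)%N.
    rewrite -(@ltn_exp2r _ _ 5) //; apply: leq_ltn_trans Mj.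
    by case/andP: iw => /leq_trans iw _; exact: iw.
  by rewrite (bigD1_seq i) ?mem_index_iota ?i0 ?ij ?iota_uniq //= iw.
rewrite exchange_big /=.
have {2}-> : j = (j.+1 - 1)%N by rewrite subn1.
rewrite -sum_nat_const_nat big_nat [leqRHS]big_nat.
apply: leq_sum => i /andP[i0 ij].
apply: leq_trans (count_interval _ _ _) _.
have : (i ^ 3 <= j ^ 3)%N by rewrite leq_exp2r.
have : (0 < i ^ 3)%N by rewrite expn_gt0 i0.
by move: (i ^ 3)%N (j ^ 3)%N (i ^ 5)%N => u v w; lia.
Qed.

Section Averages.
Variable R : realType.

Lemma average_in_window_cvg0 :
  average (fun n => (in_window n)%:R : R) @ \oo --> (0 : R).
Proof.
apply/cvgrPdist_le => e e0.
pose K := (Num.Def.truncn (4 / e)).+1.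
have K0 : 0 < K%:R :> R by rewrite ltr0n.
exists (K.+1 ^ 5)%N => // M /= KM.
have M0 : 0 < M%:R :> R by rewrite ltr0n (leq_trans _ KM) // expn_gt0.
rewrite sub0r normrN /average -natr_sum ger0_norm ?mulr_ge0 ?invr_ge0 //.
rewrite mulrC ler_pdivrMr //.
have Ke : 4 <= e * K%:R.
  by rewrite mulrC -ler_pdivrMr // ltW // truncnS_gt.
have := in_window_density _ _ KM; rewrite -(ler_nat R) !natrM.
move: (\sum_(1 <= n < M.+1) _)%N => s sM.
rewrite -(ler_pM2l K0) (le_trans sM) // mulrCA mulrA.
by rewrite ler_wpM2r // mulrC.
Qed.

(** Take S N at the centre i ^ 5 + i ^ 3 of a high window. *)
Lemma frequently_in_window K : exists2 N, (K <= N)%N &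
  2 / 3 <= average (fun n => (in_window (prime_Omega n))%:R : R) N.
Proof.
(* i ^ 5 + i ^ 3 + 1 is at most 3 * i ^ 5, and 72 * 3 = 216. *)
pose i := (K + 216)%N.
have i0 : (0 < i)%N by rewrite addn_gt0 orbT.
have i3 : (0 < i ^ 3)%N by rewrite expn_gt0 i0.
have i35 : (i ^ 3 <= i ^ 5)%N by rewrite leq_pexp2l.
have i1 : (i <= i ^ 3)%N by rewrite -{1}(expn1 i) leq_pexp2l.
have y24 : (24 <= i ^ 3)%N by apply: leq_trans i1; rewrite /i; lia.
have xy : (72 * (i ^ 5 + i ^ 3).+1 <= (i ^ 3) ^ 2)%N.
  rewrite -expnM (expnS i 5).
  apply: (@leq_trans (216 * i ^ 5)%N); first by lia.
  by rewrite leq_mul2r; apply/orP; right; rewrite /i; lia.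
have [N xN bad] := @Omega_concentration R _ _ y24 xy.
exists N; first by rewrite /i in xN i1; lia.
have N0 : 0 < N%:R :> R by rewrite ltr0n; lia.
rewrite /average [leRHS]mulrC ler_pdivlMr // -natr_sum.
have : (N <= \sum_(1 <= n < N.+1) in_window (prime_Omega n) +
   \sum_(1 <= n < N.+1)
     ~~ (i ^ 5 + i ^ 3 <= prime_Omega n + i ^ 3
           <= i ^ 5 + i ^ 3 + 2 * i ^ 3 + 1))%N.
  have {1}-> : N = (\sum_(1 <= n < N.+1) 1)%N.
    by rewrite sum_nat_const_nat subn1 muln1.
  rewrite -big_split /=.
  apply: leq_sum => n _; case: in_windowP => //= nw; rewrite add0n lt0b.
  by apply/negP => h; apply: nw; exists i => //; lia.
move: bad; move: (\sum_(_ <= _ < _) _)%N (\sum_(_ <= _ < _) _)%N => A B.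
rewrite -!(ler_nat R) natrM natrD; lra.
Qed.

(** Take S N near i ^ 5 + 2 i ^ 4, at distance more than i ^ 4 from every
    window: the window of index i ends at i ^ 5 + 2 i ^ 3 + 1, and the next one
    starts at (i + 1) ^ 5 >= i ^ 5 + 5 i ^ 4. *)
Lemma frequently_outside_window K : exists2 N, (K <= N)%N &
  average (fun n => (in_window (prime_Omega n))%:R : R) N <= 1 / 3.
Proof.
(* i ^ 5 + 2 * i ^ 4 + 1 is at most 4 * i ^ 5, and 72 * 4 = 288. *)
pose i := (K + 288)%N.
have i0 : (0 < i)%N by rewrite addn_gt0 orbT.
have i4 : (0 < i ^ 4)%N by rewrite expn_gt0 i0.
have i1 : (i <= i ^ 4)%N by rewrite -{1}(expn1 i) leq_pexp2l.
have i45 : (i ^ 4 <= i ^ 5)%N by rewrite leq_pexp2l.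
have y24 : (24 <= i ^ 4)%N by apply: leq_trans i1; rewrite /i; lia.
have xy : (72 * (i ^ 5 + 2 * i ^ 4).+1 <= (i ^ 4) ^ 2)%N.
  rewrite -expnM; apply: (@leq_trans (i ^ 6)); last by rewrite leq_pexp2l.
  rewrite (expnS i 5); apply: (@leq_trans (288 * i ^ 5)%N); first by lia.
  by rewrite leq_mul2r; apply/orP; right; rewrite /i; lia.
have [N xN bad] := @Omega_concentration R _ _ y24 xy.
exists N; first by rewrite /i in xN i1; lia.
have N0 : 0 < N%:R :> R by rewrite ltr0n; lia.
rewrite /average [leLHS]mulrC ler_pdivrMr // -natr_sum.
have : (\sum_(1 <= n < N.+1) in_window (prime_Omega n) <=
   \sum_(1 <= n < N.+1) ~~ (i ^ 5 + 2 * i ^ 4 <= prime_Omega n + i ^ 4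
       <= i ^ 5 + 2 * i ^ 4 + 2 * i ^ 4 + 1))%N.
  apply: leq_sum => n _; case: in_windowP => //= -[k k0 kw].
  rewrite lt0b; apply/negP => h.
  have [ki|ik] := leqP k i.
    have : (k ^ 5 <= i ^ 5)%N by rewrite leq_exp2r.
    have : (k ^ 3 <= i ^ 3)%N by rewrite leq_exp2r.
    have : (288 * i ^ 3 <= i ^ 4)%N.
      by rewrite (expnS i 3) leq_mul2r; apply/orP; right; rewrite /i; lia.
    have : (0 < i ^ 3)%N by rewrite expn_gt0 i0.
    by move: h kw; lia.
  have : (i.+1 ^ 5 <= k ^ 5)%N by rewrite leq_exp2r.
  have : (i ^ 5 + 5 * i ^ 4 <= i.+1 ^ 5)%N by rewrite !expnS expn0; nia.
  by move: h kw; lia.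
move: bad; move: (\sum_(_ <= _ < _) _)%N (\sum_(_ <= _ < _) _)%N => A B.
rewrite -!(ler_nat R) natrM; lra.
Qed.

Lemma average_in_window_Omega_dvg :
  ~ cvg (average (fun n => (in_window (prime_Omega n))%:R : R) @ \oo).
Proof.
move=> /cvgrPdist_lt /(_ (1 / 6)) [|K _ h]; first by lra.
have [N1 /h + h1] := frequently_in_window K.
have [N2 /h + h2] := frequently_outside_window K.
rewrite /= !ltr_norml => /andP[a b] /andP[c d].
move: a b c d h1 h2; move: (average _ N1) (average _ N2) (lim _) => r t l; lra.
Qed.

End Averages.

(** * The compact space *)

(** [0, 1] as a type of its own, to be given the metric induced by R. *)
Definition unit_interval (R : realType) : Type := {x : R | 0 <= x <= 1}.

Section UnitInterval.
Variable R : realType.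
Notation I := (unit_interval R).

HB.instance Definition _ := Choice.on I.

Lemma clamp_bounds (x : R) : 0 <= Num.max 0 (Num.min 1 x) <= 1.
Proof. by rewrite le_max lexx ge_max ler01 ge_min lexx. Qed.

(** The retraction of R onto [0, 1]: it is 1-Lipschitz and onto, hence
    transports compactness from the segment, and it also serves below to build
    points and a plateau function. *)
Definition clamp (x : R) : I :=
  exist _ (Num.max 0 (Num.min 1 x)) (clamp_bounds x).

HB.instance Definition _ := isPointed.Build I (clamp 0).

Let dist (x y : I) : R := `|val x - val y|.

Let distxx x : dist x x = 0. Proof. by rewrite /dist subrr normr0. Qed.

Let dist0 x y : dist x y = 0 -> x = y.
Proof. by move=> /normr0_eq0 /subr0_eq /val_inj. Qed.

Let distC x y : dist x y = dist y x. Proof. exact: distrC. Qed.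

Let dist_triangle y x z : dist x z <= dist x y + dist y z.
Proof. exact: ler_distD. Qed.

HB.instance Definition _ :=
  @isMetric.Build R I dist distxx dist0 distC dist_triangle.

Lemma ball_unit_intervalE (x : I) (e : R) :
  ball x e = [set y : I | `|val x - val y| < e].
Proof. by rewrite ballEmdist. Qed.

Lemma clampE (x : R) : 0 <= x <= 1 -> val (clamp x) = x.
Proof. by move=> /andP[x0 x1] /=; rewrite min_r // max_r. Qed.

Lemma clampK (x : I) : clamp (val x) = x.
Proof. by apply: val_inj; rewrite clampE // (valP x). Qed.

Lemma continuous_val : continuous (val : I -> R).
Proof.
move=> x; apply/(@cvgrPdist_lt _ _ _ (nbhs x)) => e e0.
by apply/nbhs_ballP; exists e => //= y; rewrite ball_unit_intervalE.
Qed.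

Lemma continuous_clamp : continuous (clamp : R -> I).
Proof.
move=> x; apply/cvg_ballP => e e0; near=> y.
have : `|x - y| < e by near: y; exact: cvgr_dist_lt.
rewrite ball_unit_intervalE /= !ltr_norml => /andP[xy yx].
by apply/andP; case: (leP 1 x) => ?; case: (leP 1 y) => ?;
  case: (leP 0 x) => ?; case: (leP 0 y) => ?;
  rewrite ?(max_r (@ler01 R)); split; lra.
Unshelve. all: by end_near. Qed.

Lemma compact_unit_interval : compact [set: I].
Proof.
have -> : [set: I] = clamp @` `[0, 1].
  apply/seteqP; split=> // x _; exists (val x); last exact: clampK.
  by rewrite /= in_itv /= (valP x).
apply: continuous_compact; last exact: segment_compact.
by apply: continuous_subspaceT; exact: continuous_clamp.
Qed.

End UnitInterval.
Arguments clamp {R} x.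

(** * A Dirac mass with a prescribed orbit *)

Section BorelMetric.
Variables (R : realType) (X : pmetricType R).

(** Singletons are closed, hence every countable set is Borel. *)
Lemma measurable_range_preimage (x_ : nat -> X) (A : set X) :
  @measurable _ (borelType X) (range x_ `&` A).
Proof.
have -> : range x_ `&` A = \bigcup_(n in [set n | A (x_ n)]) [set x_ n].
  apply/seteqP; split=> [y [[n _ <-] An]|y [n /= An ->]]; first by exists n.
  by split=> //; exists n.
apply: bigcup_measurable => n _.
rewrite -[X in measurable X]setCK; apply: measurableC.
apply: sub_sigma_algebra; rewrite /= openC.
apply: accessible_closed_set1; apply: hausdorff_accessible.
exact: metric_hausdorff.
Qed.

Lemma continuous_measurable_borel (f : X -> R) :
  continuous f -> measurable_fun setT (f : borelType X -> R).
Proof.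
move=> /continuousP cf.
apply: (measurability _ (RGenOpens.measurableE R)).
move=> _ [_ [a [b ->] <-]]; rewrite setTI; apply: sub_sigma_algebra.
exact/cf/interval_open.
Qed.

End BorelMetric.

Section ShiftAlong.
Variables (R : realType) (X : pmetricType R) (p : X) (x_ : nat -> X).
Hypotheses (x_inj : injective x_) (x_neq : forall n, x_ n <> p).

(** As the x_ n are distinct, the index n chosen here is determined by y. *)
Definition shift_along (y : X) : X :=
  if pselect (exists n, x_ n = y) is left e then x_ (projT1 (cid e)).+1 else p.

Lemma shift_alongE n : shift_along (x_ n) = x_ n.+1.
Proof.
rewrite /shift_along; case: pselect => [e|]; last by case; exists n.
by case: cid => /= m /x_inj ->.
Qed.

Lemma shift_along_out y : ~ range x_ y -> shift_along y = p.
Proof.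
by rewrite /shift_along; case: pselect => // -[n xny] []; exists n.
Qed.

Lemma shift_along_fixed : shift_along p = p.
Proof. by apply: shift_along_out => -[n _ /x_neq]. Qed.

Lemma iter_shift_along n : iter n shift_along (x_ 0) = x_ n.
Proof. by elim: n => //= n ->; exact: shift_alongE. Qed.

(** On the range of x_ every subset is Borel, and outside it the map is
    constant. *)
Lemma measurable_shift_along :
  measurable_fun setT (shift_along : borelType X -> borelType X).
Proof.
move=> _ A mA; rewrite setTI.
have mran : @measurable _ (borelType X) (range x_).
  by rewrite -[range x_]setIT; exact: measurable_range_preimage.
have -> : shift_along @^-1` A = range x_ `&` (shift_along @^-1` A) `|`
    ~` range x_ `&` (shift_along @^-1` A).
  by rewrite -setIUl setUv setTI.
apply: measurableU; first exact: measurable_range_preimage.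
have [Ap|nAp] := pselect (A p).
  rewrite setIidl; first exact: measurableC.
  by move=> y /shift_along_out /= ->.
rewrite (_ : _ `&` _ = set0); first exact: measurable0.
by rewrite -subset0 => y [/shift_along_out /= ->].
Qed.

Let mu : probability (borelType X) R := dirac (p : borelType X).

Lemma shift_along_dirac_preserving :
  measure_preserving mu (shift_along : borelType X -> borelType X).
Proof.
split=> [|A mA]; first exact: measurable_shift_along.
rewrite /mu /= !diracE; congr (_%:R%:E); congr nat_of_bool.
by apply/idP/idP; rewrite !inE /= shift_along_fixed.
Qed.

End ShiftAlong.
Arguments shift_along {R X} p x_ y.

Lemma dirac_ergodic (R : realType) (d : measure_display)
    (X : measurableType d) (p : X) (T : X -> X) :
  ergodic (dirac p : probability X R) T.
Proof.
by move=> A _ _; rewrite /= diracE; case: (p \in A); [right|left].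
Qed.

Lemma Rintegral_dirac_continuous (R : realType) (X : pmetricType R) (p : X)
    (f : X -> R) : continuous f ->
  \int[(dirac (p : borelType X) : probability (borelType X) R)]_y f y = f p.
Proof.
move=> cf; rewrite /Rintegral integral_dirac //; last first.
  by apply/measurable_EFinP; exact: continuous_measurable_borel.
by rewrite diracE in_setT mul1e.
Qed.

Lemma average_cvg (R : realType) (u : nat -> R) (l : R) :
  u @ \oo --> l -> average u @ \oo --> l.
Proof.
move=> ul; rewrite -cvg_shiftS.
have /cesaro : (fun n => u n.+1) @ \oo --> l by rewrite cvg_shiftS.
suff -> : arithmetic_mean (fun n => u n.+1) = (fun n => average u n.+1) by [].
apply/funext => n.
by rewrite /arithmetic_mean /average seriesEnat /= [in RHS]big_add1.
Qed.

Section Realization.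
Variable R : realType.
Notation I := (unit_interval R).

(** At the times n outside a, f (T^n x) is close to f p because T^n x = z n
    tends to p; the other times have density zero, and f is bounded. *)
Lemma generic_dirac_of_density_zero (X : pmetricType R) (p : X)
    (a : nat -> bool) (z : nat -> X) (T : borelType X -> borelType X) (x : X) :
  compact [set: X] -> z @ \oo --> p ->
  (forall n, ~~ a n -> iter n T x = z n) ->
  average (fun n => (a n)%:R : R) @ \oo --> (0 : R) ->
  generic (dirac (p : borelType X) : probability (borelType X) R) T x.
Proof.
move=> cptX zp Tz a0 f cf; rewrite Rintegral_dirac_continuous //.
pose g (y : X) : R := `|f y - f p|.
have cg : continuous g.
  by move=> y; apply: cvg_norm; apply: cvgB; [exact: cf|exact: cvg_cst].
have [B fB] : exists B : R, forall y, g y <= B.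
  have X0 : [set: X] !=set0 by exists p.
  have [c _ gc] := compact_EVT_max X0 cptX (continuous_subspaceT cg).
  by exists (g c) => y; apply: gc; rewrite in_setT.
have b0 : average (fun n => B * (a n)%:R + `|f (z n) - f p|) @ \oo --> (0 : R).
  have fz : (fun n => `|f (z n) - f p|) @ \oo --> (0 : R).
    have <- : g p = 0 by rewrite /g subrr normr0.
    by apply: (@continuous_cvg _ _ _ \oo _ z g p); [exact: cg|exact: zp].
  have -> : average (fun n => B * (a n)%:R + `|f (z n) - f p|) =
    (fun N => B * average (fun n => (a n)%:R) N +
              average (fun n => `|f (z n) - f p|) N).
    apply/funext => N; rewrite /average big_split /= -mulr_sumr; ring.
  rewrite -[X in _ --> X](addr0 0) -{1}(mulr0 B); apply: cvgD.
    exact: cvgMl_tmp.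
  exact: average_cvg.
apply/cvgrPdist_le => e e0; near=> N.
have N0 : 0 < N%:R :> R by rewrite ltr0n; near: N; exact: nbhs_infty_gt.
have : average (fun n => B * (a n)%:R + `|f (z n) - f p|) N <= e.
  apply: le_trans (ler_norm _) _; rewrite -normrN -sub0r.
  by near: N; exact: cvgr_dist_le.
apply: le_trans; rewrite distrC.
have -> : average (fun n => f (iter n T x)) N - f p =
    average (fun n => f (iter n T x) - f p) N.
  rewrite /average sumrB sumr_const_nat subn1 /= mulrBr.
  by rewrite -[f p *+ N]mulr_natl mulKf // gt_eqF.
rewrite /average normrM gtr0_norm ?invr_gt0 //.
apply: ler_wpM2l; first by rewrite invr_ge0 ltW.
apply: le_trans (ler_norm_sum _ _ _) _; apply: ler_sum => n _.
have [an|an] := boolP (a n); last by rewrite mulr0 add0r Tz.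
by rewrite mulr1 ler_wpDr //; exact: fB.
Unshelve. all: by end_near. Qed.

(** The shift by 3 keeps the points in ]0, 1 / 3] or in [2 / 3, 1[, where the
    plateau function y |-> clamp (3 y - 1) takes the values 0 and 1, and away
    from the fixed point 0. *)
Definition orbit_point (a : nat -> bool) (n : nat) : I :=
  clamp (if a n then 1 - n.+3%:R^-1 else n.+3%:R^-1).

(** T needs only to be Borel, so the orbit may jump between the neighbourhoods of
    0 and of 1 in whatever order a dictates. *)
Lemma density_zero_realization (a : nat -> bool) :
  average (fun n => (a n)%:R : R) @ \oo --> (0 : R) ->
  exists (X : pmetricType R) (mu : probability (borelType X) R)
         (T : borelType X -> borelType X) (x : X) (F : X -> R),
    [/\ compact [set: X], measure_preserving mu T /\ ergodic mu T,
        generic mu T x, continuous F & forall n, F (iter n T x) = (a n)%:R].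
Proof.
move=> a0; pose p : I := clamp 0.
have small n : 0 < (n.+3%:R^-1 : R) <= 3^-1.
  by rewrite invr_gt0 ltr0n /= lef_pV2 ?posrE ?ltr0n // ler_nat.
have pE : val p = 0 by rewrite clampE // lexx ler01.
have xE n : val (orbit_point a n) = if a n then 1 - n.+3%:R^-1 else n.+3%:R^-1.
  by rewrite clampE //; have := small n; case: (a n); move: (_^-1) => t; lra.
have x_inj : injective (orbit_point a).
  move=> m n /(congr1 val); rewrite !xE; have := small m; have := small n.
  have inj : m.+3%:R^-1 = n.+3%:R^-1 :> R -> m = n.
    by move=> /invr_inj /eqP; rewrite eqr_nat => /eqP [].
  move: inj; case: (a m); case: (a n);
    move: (m.+3%:R^-1) (n.+3%:R^-1) => s t inj *;
    try (by apply: inj; lra); exfalso; lra.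
have x_neq n : orbit_point a n <> p.
  move=> /(congr1 val); rewrite xE pE; have := small n.
  by case: (a n); move: (_^-1) => t; lra.
pose T : borelType I -> borelType I := shift_along p (orbit_point a).
have Tx n : iter n T (orbit_point a 0) = orbit_point a n.
  exact: iter_shift_along.
exists I, (dirac (p : borelType I)), T, (orbit_point a 0).
exists (fun y : I => val (clamp (3 * val y - 1))); split.
- exact: compact_unit_interval.
- split; last exact: dirac_ergodic.
  exact: shift_along_dirac_preserving.
- apply: (@generic_dirac_of_density_zero _ _ a (fun n => clamp n.+3%:R^-1)) => //.
  + exact: compact_unit_interval.
  + apply: cvg_comp; last exact: continuous_clamp.
    have -> : (fun n => n.+3%:R^-1) = (fun n => @harmonic R (n + 2)%N).
      by apply/funext => n; rewrite /harmonic /= addn2.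
    by rewrite (@cvg_shiftn 2 R^o (@harmonic R)); exact: cvg_harmonic.
  + by move=> n /negPf an; rewrite Tx /orbit_point an.
- have affine : continuous (fun t : R => 3 * t - 1).
    by move=> t; apply: cvgB; [exact: cvgMl_tmp|exact: cvg_cst].
  move=> y; apply: (@cvg_comp _ _ _ (fun y : I => clamp (3 * val y - 1)) val).
    apply: (@cvg_comp _ _ _ (fun y : I => 3 * val y - 1) clamp).
      apply: (@cvg_comp _ _ _ (val : I -> R) (fun t : R => 3 * t - 1)).
        exact: continuous_val.
      exact: affine.
    exact: continuous_clamp.
  exact: continuous_val.
- move=> n; rewrite Tx xE /=; have := small n; case: (a n) => /= t3.
  + by rewrite min_l ?max_r //; move: t3; move: (_^-1) => t; lra.
  + by rewrite min_r ?max_l //; move: t3; move: (_^-1) => t; lra.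
Qed.

End Realization.

(** * Oscillation along Omega *)

Theorem proposition3p1 (R : realType) :
  exists (X : pmetricType R) (mu : probability (borelType X) R)
         (T : borelType X -> borelType X) (x : X) (F : X -> R),
    [/\ compact [set: X],
        measure_preserving mu T /\ ergodic mu T,
        generic mu T x,
        continuous F &
        ~ cvg (average (fun n => F (iter (prime_Omega n) T x)) @ \oo)].
Proof.
have [X [mu [T [x [F [cptX [mpT ergT] genx cF FT]]]]]] :=
  @density_zero_realization R in_window (average_in_window_cvg0 R).
exists X, mu, T, x, F; split=> //.
have -> : (fun n => F (iter (prime_Omega n) T x)) =
    (fun n => (in_window (prime_Omega n))%:R) by apply/funext.
exact: average_in_window_Omega_dvg.
Qed.
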